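(* Let $p$ be any prime, $n\ge1$, and $G=\mathrm{Hol}(C_{p^n})$. Then $c(G)=q(G)=p(G)=p^n$.
   Context: $C_m$ is the cyclic group of order $m$; $\mathrm{Hol}(C_m)=C_m\rtimes\mathrm{Aut}(C_m)$ for the natural action. For a finite group $G$: $p(G)$ is the minimal degree of a faithful permutation representation of $G$, i.e. the least positive integer $m$ such that $G$ embeds in the symmetric group $S_m$. A square matrix over $\mathbb{C}$ is a quasi-permutation matrix if its trace is a non-negative integer. $c(G)$ (resp. $q(G)$) is the minimal degree of a faithful representation of $G$ by quasi-permutation matrices over $\mathbb{C}$ (resp. over $\mathbb{Q}$), i.e. the least degree of a faithful representation $G\to\mathrm{GL}_m(\mathbb{C})$ (resp. $\mathrm{GL}_m(\mathbb{Q})$) all of whose matrices are quasi-permutation matrices. *)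

(* Defs.v *)
From HB Require Import structures.
From mathcomp Require Import all_boot all_order all_fingroup all_algebra.
From mathcomp Require Import all_solvable all_character.
From mathcomp Require Import complex reals.

Set Implicit Arguments.
Unset Strict Implicit.
Unset Printing Implicit Defensive.

Import GRing.Theory.
Local Open Scope ring_scope.

(* [Aut A] is the evaluation action of Aut A on A; an element of the external
   semidirect product is a pair (a, x) with a in Aut A and x in A. *)
Definition Hol (gT : finGroupType) (A : {group gT}) :
    {group sdprod_by [Aut A]%gact} :=
  [set: sdprod_by [Aut A]%gact]%G.

Definition quasi_permutation_mx (F : fieldType) (m : nat) (M : 'M[F]_m) : Prop :=
  exists k : nat, \tr M = k%:R.

Definition faithful_qperm_degree (F : fieldType) (gT : finGroupType)
    (G : {group gT}) (m : nat) : Prop :=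
  exists2 rG : mx_representation F G m,
    mx_faithful rG & forall x, x \in G -> quasi_permutation_mx (rG x).

Definition faithful_perm_degree (gT : finGroupType) (G : {group gT}) (m : nat) :
    Prop :=
  exists f : {morphism G >-> 'S_m}, ('injm f)%g.

Definition is_least_pos (P : nat -> Prop) (m : nat) : Prop :=
  [/\ (0 < m)%N, P m & forall k : nat, (0 < k)%N -> P k -> (m <= k)%N].

(* The minimal degrees are encoded by their graphs: is_c R G m reads c(G) = m.
   The field of complex numbers is R[i] for R a model of the real numbers. *)
Definition is_p (gT : finGroupType) (G : {group gT}) (m : nat) : Prop :=
  is_least_pos (faithful_perm_degree G) m.

Definition is_c (R : realType) (gT : finGroupType) (G : {group gT}) (m : nat) :
    Prop :=
  is_least_pos (faithful_qperm_degree (R[i] : fieldType) G) m.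

Definition is_q (gT : finGroupType) (G : {group gT}) (m : nat) : Prop :=
  is_least_pos (faithful_qperm_degree (rat : fieldType) G) m.

(* Main.v *)
Require Import Defs.
From HB Require Import structures.
From mathcomp Require Import all_boot all_order all_fingroup all_algebra.
From mathcomp Require Import all_solvable all_field all_character.
From mathcomp Require Import complex reals zify.

(* Upper bound: the copy of Aut(C) in Hol(C) is a core-free subgroup of index
   |C|, and a permutation representation is one by quasi-permutation matrices.

   Lower bound: let x generate C, of order N = p^(n+1), and let z = x^(p^n).  In
   a faithful representation of degree m over C (which bounds the rational ones)
   the matrix of x is diagonalizable with N-th roots of unity as eigenvalues.
   Let a be the number of eigenvalues (with multiplicity) that are primitive; as
   z acts nontrivially, a > 0.  Since x is conjugate to x^k for every k prime to
   p, all primitive N-th roots of unity occur, so a >= (p-1)p^n.  The nontrivial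
   powers of z are conjugate, hence have the same trace c >= 0, and summing the
   traces of all powers of z gives p(m - a) = m + (p-1)c >= m, that is,
   (p-1)m >= pa, whence m >= p^(n+1). *)

Set Implicit Arguments.
Unset Strict Implicit.
Unset Printing Implicit Defensive.

Import GRing.Theory Num.Theory.
Local Open Scope ring_scope.

(** * Diagonalization of matrices of finite order *)

Lemma diag_exp_conj (F : fieldType) (m : nat) (X P : 'M[F]_m.+1) d :
    P *m X = diag_mx d *m P ->
  forall k, P *m X ^+ k = diag_mx (\row_j d 0 j ^+ k) *m P.
Proof.
move=> Pd; elim=> [|k IH].
  rewrite expr0 mulmx1 (_ : \row_j _ = const_mx 1) ?diag_const_mx ?mul1mx //.
  by apply/rowP => j; rewrite !mxE expr0.
rewrite exprSr mulmxA IH -mulmxA Pd mulmxA mulmx_diag.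
by congr (diag_mx _ *m _); apply/rowP => j; rewrite !mxE exprSr.
Qed.

(** The minimal polynomial of [X] divides ['X^N - 1], which splits over [F] and is separable in
    characteristic 0. *)
Lemma torsion_diagonalizable (F : numClosedFieldType) (m N : nat)
    (X : 'M[F]_m.+1) :
    (0 < N)%N -> X ^+ N = 1 ->
  exists2 P, P \in unitmx &
    exists2 d : 'rV[F]_m.+1, P *m X = diag_mx d *m P &
      forall i, d 0 i ^+ N = 1.
Proof.
move=> N0 XN; have [s Ds] := closed_field_poly_normal ('X^N - 1 : {poly F}).
move: Ds; rewrite lead_coefXnsubC // scale1r => Ds.
have us : uniq s.
  rewrite -separable.separable_prod_XsubC -Ds separable_Xn_sub_1 //.
  by rewrite pnatr_eq0 -lt0n.
have [P Pu /diagonalizable_forPex[d /(simmxP Pu) Pd]] : diagonalizable X.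
  apply/diagonalizableP; exists s; rewrite // -Ds mxminpoly_min //.
  by rewrite rmorphB rmorphXn /= horner_mx_X XN rmorph1 subrr.
exists P => //; exists d => // i.
move: (diag_exp_conj Pd N); rewrite XN mulmx1 -{1}[P]mul1mx.
by move=> /(can_inj (mulmxK Pu)) /matrixP/(_ i i); rewrite !mxE eqxx.
Qed.

(** The minimal polynomial is a similarity invariant, so eigenvalues can be carried over between
    conjugate matrices such as [X] and [X ^+ k]. *)
Lemma diag_conj_eigen (F : fieldType) (m : nat) (X P : 'M[F]_m.+1) d a :
    P \in unitmx -> P *m X = diag_mx d *m P ->
  reflect (exists i, d 0 i = a) (root (mxminpoly X) a).
Proof.
move=> Pu Pd; have -> : mxminpoly X = mxminpoly (diag_mx d).
  by apply: (simmx_minpoly Pu); apply/simmxP.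
rewrite mxminpoly_diag root_prod_XsubC mem_undup.
apply: (iffP mapP) => [[i _ ->]|[i <-]]; exists i => //.
by rewrite mem_enum.
Qed.

Lemma mxtrace_conj (R : comUnitRingType) (m : nat) (A B P : 'M[R]_m) :
  P \in unitmx -> P *m A = B *m P -> \tr A = \tr B.
Proof.
move=> Pu PAB; rewrite -[A](mulKmx Pu) PAB mxtrace_mulC -mulmxA.
by rewrite mulmxV // mulmx1.
Qed.

(** * Roots of unity and the lower bound *)

Lemma card_coprime_ord (N : nat) : #|[set k : 'I_N | coprime N k]| = totient N.
Proof.
rewrite totient_count_coprime big_mkord -sum1_card big_mkcond.
by apply: eq_bigr => i _; rewrite inE; case: coprime.
Qed.

Lemma prime_pow_order_root (F : idomainType) (p n : nat) (w : F) :
    prime p -> w ^+ (p ^ n.+1) = 1 -> w ^+ (p ^ n) != 1 ->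
  (p ^ n.+1).-primitive_root w.
Proof.
move=> pp w1 wn1; have p0 : (0 < p ^ n.+1)%N by rewrite expn_gt0 prime_gt0.
have [k wk kd] := prim_order_exists p0 w1.
have [[|j] jn Dk] := dvdn_pfactor _ n.+1 pp kd; last first.
  move: jn; rewrite leq_eqVlt => /predU1P[<-|jn]; first by rewrite -Dk.
  case/negP: wn1; rewrite -(prim_order_dvd wk) Dk dvdn_exp2l //.
case/negP: wn1; rewrite -(prim_order_dvd wk) Dk expn0 dvd1n //.
Qed.

Lemma root_sum_eq0 (F : idomainType) (p : nat) (w : F) :
  w ^+ p = 1 -> w != 1 -> \sum_(t < p) w ^+ t = 0.
Proof.
move=> wp w1; apply/eqP; move/eqP: (subrX1 w p).
by rewrite wp subrr eq_sym mulf_eq0 subr_eq0 (negPf w1).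
Qed.

Lemma conjugate_powers_degree_bound (F : numClosedFieldType) (p n m c : nat)
    (X : 'M[F]_m.+1) :
    prime p -> X ^+ (p ^ n.+1) = 1 -> X ^+ (p ^ n) != 1 ->
    (forall k, coprime p k ->
      exists2 U, U \in unitmx & U *m X = X ^+ k *m U) ->
    \tr (X ^+ (p ^ n)) = c%:R ->
  (p ^ n.+1 <= m.+1)%N.
Proof.
move=> pp X1 Xn1 Xconj trX.
have p_gt0 := prime_gt0 pp.
have N_gt0 : (0 < p ^ n.+1)%N by rewrite expn_gt0 p_gt0.
have [P Pu [d Pd d1]] := torsion_diagonalizable N_gt0 X1.
(* By [d1], these are the positions of the primitive [p ^ n.+1]-th roots of unity; [#|A|] is the
   number a of the overview. *)
pose A := [set i | d 0 i ^+ (p ^ n) != 1].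
have cardA : (p.-1 * p ^ n <= #|A|)%N.
  have [i0 Ai0] : exists i, i \in A.
    apply/set0Pn; apply: contra Xn1 => /eqP A0.
    rewrite -[X ^+ _](mulKmx Pu) (diag_exp_conj Pd).
    rewrite (_ : \row_j _ = const_mx 1) ?diag_const_mx ?mul1mx ?mulVmx //.
    apply/rowP => j; rewrite !mxE; apply/eqP.
    by move/setP/(_ j): A0; rewrite !inE => /negbFE.
  have wprim : (p ^ n.+1).-primitive_root (d 0 i0).
    by apply: prime_pow_order_root => //; move: Ai0; rewrite inE.
  (* Stating coprimality as a boolean premise makes the existence hold for every [k], so that
     [xchoose] yields a total function [f]. *)
  have dk (k : 'I_(p ^ n.+1)) : exists j, coprime (p ^ n.+1) k ==>
      (d 0 j == d 0 i0 ^+ k).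
    case copk: (coprime _ _); last by exists i0.
    have [|U Uu UX] := Xconj k; first by rewrite coprime_pexpl in copk.
    suff /(diag_conj_eigen _ Pu Pd)[j dj] : root (mxminpoly X) (d 0 i0 ^+ k).
      by exists j; rewrite dj eqxx.
    have -> : mxminpoly X = mxminpoly (X ^+ k).
      by apply: (simmx_minpoly Uu); apply/simmxP.
    apply/(diag_conj_eigen _ Pu (diag_exp_conj Pd k)).
    by exists i0; rewrite mxE.
  pose f k := xchoose (dk k).
  have fP (k : 'I_(p ^ n.+1)) : coprime (p ^ n.+1) k -> d 0 (f k) = d 0 i0 ^+ k.
    by move=> copk; apply/eqP/(implyP (xchooseP (dk k))).
  rewrite -(totient_pfactor pp (ltn0Sn n)) -card_coprime_ord.
  rewrite -(card_in_imset (f := f)) => [|k l]; last first.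
    rewrite !inE => /fP dfk /fP dfl fkl; apply/val_inj/eqP => /=.
    have /eqP := dfk; rewrite fkl dfl (eq_prim_root_expr wprim).
    by rewrite !modn_small // eq_sym.
  (* If [f k] were outside [A], then [p ^ n.+1] would divide [k * p ^ n], hence [p ^ n], as [k] is
     coprime to it. *)
  apply/subset_leq_card/subsetP => _ /imsetP[k + ->]; rewrite !inE => copk.
  rewrite fP // -exprM -(prim_order_dvd wprim).
  rewrite Gauss_dvdr // dvdn_Pexp2l ?prime_gt1 // ltnn //.
have trE k : \tr (X ^+ k) = \sum_i d 0 i ^+ k.
  rewrite (mxtrace_conj Pu (diag_exp_conj Pd k)) mxtrace_diag.
  by apply: eq_bigr => i _; rewrite mxE.
have trt (t : 'I_p) : \tr (X ^+ (p ^ n * t)) =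
    if t == 0%N :> nat then m.+1%:R else c%:R.
  case: eqP => [->|/eqP t0]; first by rewrite muln0 mxtrace1.
  (* A nonzero [t] below [p] is prime to [p]; the matrix conjugating [X] to [X ^+ t] also conjugates
     their [p ^ n]-th powers. *)
  have [|U Uu UX] := Xconj t.
    by rewrite prime_coprime // gtnNdvd ?lt0n.
  rewrite mulnC exprM -trX; apply/esym/(mxtrace_conj Uu).
  elim: (p ^ n)%N => [|k IH]; first by rewrite !expr0 mulmx1 mul1mx.
  by rewrite !exprSr mulmxA IH -!mulmxA UX.
have trace_count : (p * (m.+1 - #|A|) = m.+1 + p.-1 * c)%N.
  apply/eqP; rewrite -(eqr_nat F); apply/eqP.
  (* Double counting: summed over [t] first, an index outside [A] contributes [p], and one in [A]
     contributes 0, being a full sum of powers of a nontrivial [p]-th root of unity. *)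
  transitivity (\sum_(t < p) \tr (X ^+ (p ^ n * t))); last first.
    case: p p_gt0 trt {pp X1 Xn1 Xconj trX N_gt0 d1 A cardA} => // p _ trt.
    rewrite big_ord_recl trt eqxx natrD natrM; congr (_ + _).
    rewrite (eq_bigr (fun=> c%:R)) => [|i _]; last by rewrite trt lift0.
    by rewrite sumr_const card_ord mulr_natl.
  under eq_bigr do rewrite trE.
  rewrite exchange_big /= (bigID (mem A)) /= big1 ?add0r => [|i].
    rewrite (eq_bigr (fun=> p%:R)) => [|i]; last first.
      rewrite inE negbK => /eqP di; under eq_bigr do rewrite exprM di expr1n.
      by rewrite sumr_const card_ord.
    rewrite sumr_const -[RHS]mulr_natr natrM; congr (_ * _%:R).
    by rewrite -{1}[m.+1]card_ord -(cardC A) addKn.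
  rewrite inE => Ai; under eq_bigr do rewrite exprM.
  by apply: root_sum_eq0; rewrite // -exprM -expnSr d1.
have Am : (#|A| <= m.+1)%N by apply: leq_trans (max_card _) _; rewrite card_ord.
have p1_gt0 : (0 < p.-1)%N by rewrite -subn1 subn_gt0 prime_gt1.
move: trace_count cardA Am; rewrite expnS -(prednK p_gt0) /=.
move: p.-1 p1_gt0 #|A| (_ ^ n)%N => r r_gt0 a q key raq am.
(* With [r] = p - 1, it suffices that r(r+1)q <= (r+1)a <= r(m+1); the second inequality rearranges
   m+1 <= (r+1)(m+1-a). *)
rewrite -(leq_pmul2l r_gt0) mulnCA.
apply: leq_trans (leq_mul (leqnn r.+1) raq) _.
have : (m.+1 <= r.+1 * (m.+1 - a))%N by rewrite key leq_addr.
by lia.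
Qed.

Lemma prime_power_cycle_qperm_degree (F : numClosedFieldType)
    (gT : finGroupType) (G : {group gT}) (x : gT) (p n m : nat) :
    prime p -> x \in G -> #[x]%g = (p ^ n.+1)%N ->
    (forall k, coprime p k -> exists2 u, u \in G & (x ^ u)%g = (x ^+ k)%g) ->
    (0 < m)%N -> faithful_qperm_degree F G m ->
  (p ^ n.+1 <= m)%N.
Proof.
move=> pp Gx ox xconj; case: m => // m _ [rG faithG qG].
have rX k : rG (x ^+ k)%g = rG x ^+ k.
  elim: k => [|k IH]; first by rewrite expg0 repr_mx1.
  by rewrite expgSr repr_mxM ?groupX // IH exprSr.
have [c trc] : exists c, \tr (rG x ^+ (p ^ n)) = c%:R.
  by rewrite -rX; apply: qG; rewrite groupX.
apply: (conjugate_powers_degree_bound (X := rG x) pp _ _ _ trc).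
- by rewrite -rX -ox expg_order repr_mx1.
- rewrite -rX; apply: contraTneq isT => x1.
  have: (x ^+ (p ^ n))%g \in rker rG by apply/rkerP; rewrite groupX.
  move/(subsetP faithG)/set1gP/eqP; rewrite -order_dvdn ox.
  by rewrite dvdn_Pexp2l ?prime_gt1 // ltnn.
- move=> k /xconj[u Gu xu]; have Gu' := groupVr Gu.
  (* As [x ^ u] is u^-1 x u, it is u^-1 that satisfies u^-1 x = x^k u^-1. *)
  exists (rG u^-1%g); first by rewrite repr_mx_unit.
  rewrite -rX -!repr_mxM ?groupX // -xu conjgE.
  by rewrite !mulgA mulgK.
Qed.

(** * Permutation representations *)

Lemma perm_degree_qperm_degree (F : fieldType) (gT : finGroupType)
    (G : {group gT}) (m : nat) :
  faithful_perm_degree G m -> faithful_qperm_degree F G m.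
Proof.
case=> f injf.
have rP : mx_repr G (fun x => perm_mx (f x) : 'M[F]_m).
  split=> [|x y Gx Gy]; first by rewrite morph1 perm_mx1.
  by rewrite morphM // perm_mxM.
exists (MxRepresentation rP) => [|x Gx].
  apply/subsetP=> x /rkerP[Gx /= fx1].
  apply/set1gP/(injmP injf); rewrite ?group1 // morph1.
  apply/permP => i; move/matrixP/(_ i (f x i)): fx1.
  rewrite !mxE !eqxx perm1; case: eqP => // _ /eqP.
  by rewrite oner_eq0.
(* The trace of a permutation matrix counts fixed points. *)
exists #|[set i | f x i == i]|; rewrite /= /mxtrace.
rewrite -sum1_card natr_sum [RHS]big_mkcond.
by apply: eq_bigr => i _; rewrite !mxE inE; case: (_ == _).
Qed.

Lemma qperm_degree_map (aF rF : fieldType) (f : {rmorphism aF -> rF})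
    (gT : finGroupType) (G : {group gT}) (m : nat) :
  faithful_qperm_degree aF G m -> faithful_qperm_degree rF G m.
Proof.
case=> rG faithG qG; exists (map_repr f rG); first by rewrite map_mx_faithful.
move=> x /qG[k trk]; exists k.
by rewrite map_reprE trace_map_mx trk rmorph_nat.
Qed.

(** The kernel of right multiplication on the right cosets of [H] is the core of [H]. *)
Lemma core_free_perm_degree (gT : finGroupType) (G H : {group gT}) :
    H \subset G -> gcore H G = 1%g ->
  faithful_perm_degree G #|G : H|%g.
Proof.
move=> sHG coreH1.
have HS : (H : {set gT}) \in rcosets H G
  by apply/rcosetsP; exists 1%g; rewrite ?mulg1.
have stabS x (i : 'I_#|rcosets H G|) :
    x \in G -> (enum_val i :* x)%g \in rcosets H G.
  move=> Gx; have : enum_val i \in rcosets H G := enum_valP i.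
  case/rcosetsP=> y Gy ->.
  by apply/rcosetsP; exists (y * x)%g; rewrite ?groupM // rcosetM.
(* The identity as default outside [G] makes [h x] injective for every [x], as [perm] requires. *)
pose h x (i : 'I_#|rcosets H G|) :=
  if x \in G then enum_rank_in HS ((enum_val i :* x)%g) else i.
have hE x i : x \in G -> enum_val (h x i) = (enum_val i :* x)%g.
  by move=> Gx; rewrite /h Gx enum_rankK_in ?stabS.
have h_inj x : injective (h x).
  move=> i j; case Gx: (x \in G); last by rewrite /h Gx.
  move/(congr1 enum_val); rewrite !hE // => /(congr1 (fun B => B :* x^-1)%g).
  by rewrite /= -!rcosetM mulgV !mulg1 => /enum_val_inj.
have h_morph : {in G &, {morph (fun x => perm (h_inj x)) : x y / (x * y)%g}}.
  move=> x y Gx Gy; apply/permP => i; apply: enum_val_inj.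
  by rewrite permM !permE !hE ?groupM // rcosetM.
exists (Morphism h_morph); apply/subsetP => x /morphpreP[Gx /set1P/= hx1].
rewrite -coreH1 -astabRs_rcosets !inE; apply/subsetP => A SA.
rewrite !inE; apply/eqP => /=.
by rewrite -(enum_rankK_in HS SA) rcosetE -hE // -[h x _]permE hx1 perm1.
Qed.

(** * The holomorph: core-free complement and conjugate powers *)

Section Holomorph.

Variables (gT : finGroupType) (C : {group gT}).

Let W := (sdpair1 [Aut C]%gact @* C)%g.
Let K := (sdpair2 [Aut C]%gact @* Aut C)%g.

(** The core and [W] normalize each other and meet trivially, so they commute; but only the trivial
    automorphism fixes [C] pointwise. *)
Lemma holomorph_complement_core : gcore K (Hol C) = 1%g.
Proof.
have KW1 : W :&: K = 1%g by apply: im_sdpair_TI.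
apply/trivgP/subsetP => g gK; have Kg := subsetP (gcore_sub _ _) g gK.
have cWg : g \in 'C(W)%g.
  apply/centP => w Ww; apply/commgP.
  suff: [~ g, w]%g \in W :&: K by rewrite KW1 => /set1gP->.
  rewrite inE; apply/andP; split.
    have nWg: g \in 'N(W)%g by apply: subsetP Kg; apply: im_sdpair_norm.
    by rewrite commgEr groupM ?memJ_norm ?groupV.
  rewrite commgEl groupM ?groupV //.
  apply: (subsetP (gcore_sub K (Hol C))).
  by rewrite memJ_norm //; apply: subsetP (in_setT w); apply: gcore_norm.
have [a _ Aa ga] := morphimP Kg.
suff a1 : a = 1%g by rewrite ga a1 morph1 inE.
apply: (eq_Aut Aa (group1 _)) => x Cx; rewrite perm1.
have toE : [Aut C]%gact x a = a x by [].
apply: (injmP (injm_sdpair1 [Aut C]%gact)) => //.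
  by rewrite -toE gact_stable.
rewrite -toE; have /= -> := sdpair_act [Aut C]%gact Cx Aa.
rewrite -ga conjgE -(centP cWg) ?mulKg //.
by rewrite mem_morphim.
Qed.

Lemma holomorph_complement_index : #|Hol C : K|%g = #|C|.
Proof.
have defG := sdprod_sdpair [Aut C]%gact.
rewrite -(card_injm (injm_sdpair1 [Aut C]%gact) (subxx C)).
have /sdprod_card := defG; rewrite -/W -/K => cG.
by rewrite -divgS ?subsetT //= -cG mulnK.
Qed.

End Holomorph.

Lemma holomorph_perm_degree (gT : finGroupType) (C : {group gT}) :
  faithful_perm_degree (Hol C) #|C|.
Proof.
rewrite -holomorph_complement_index; apply: core_free_perm_degree.
  exact: subsetT.
exact: holomorph_complement_core.
Qed.

(** The [k]-th power map is an automorphism of [C], and the holomorph realizes it as a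
    conjugation. *)
Lemma holomorph_conj_expg (gT : finGroupType) (C : {group gT}) (x : gT) k :
    C :=: <[x]>%g -> coprime #[x]%g k ->
  exists2 u, u \in Hol C &
    (sdpair1 [Aut C]%gact x ^ u = sdpair1 [Aut C]%gact x ^+ k)%g.
Proof.
move=> defC copk; have Cx : x \in C by rewrite defC cycle_id.
have injk : ('injm (cyclem k x))%g.
  apply/subsetP=> y /setIdP[xy]; rewrite !inE -order_dvdn => yk.
  by rewrite -order_eq1 -dvdn1 -(eqP copk) dvdn_gcd order_dvdG.
have imk : (cyclem k x @* <[x]> = <[x]>)%g.
  apply/morphim_fixP=> //; rewrite morphim_cycle ?cycle_id //.
  by rewrite cycleX.
pose a := aut injk imk; have Aa : a \in Aut C by rewrite defC Aut_aut.
exists (sdpair2 [Aut C]%gact a); first by rewrite inE.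
have /= <- := sdpair_act [Aut C]%gact Cx Aa.
rewrite -morphX //; congr sdpair1.
by rewrite -[LHS]/(a x) autE ?cycle_id.
Qed.

Local Close Scope ring_scope.

Theorem theorem10p2p2 (R : realType) (p n : nat) (gT : finGroupType)
    (C : {group gT}) (hp : prime p) (hn : 1 <= n)
    (hC : cyclic C) (hcard : #|C| = p ^ n) :
  [/\ is_c R (Hol C) (p ^ n), is_q (Hol C) (p ^ n) & is_p (Hol C) (p ^ n)].
Proof.
have lowerC m : (0 < m)%N -> faithful_qperm_degree R[i] (Hol C) m ->
    (p ^ n <= m)%N.
  (* [hn] excludes exponent 0, so [n] takes the successor form of the degree bound. *)
  have /cyclicP[x defC] := hC; case: n hn hcard => // n _ cardC.
  have ox : #[x]%g = (p ^ n.+1)%N by rewrite -cardC defC.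
  have Cx : x \in C by rewrite defC cycle_id.
  apply: (prime_power_cycle_qperm_degree (x := sdpair1 [Aut C]%gact x)) => //.
  - by rewrite inE.
  - by rewrite (order_injm (injm_sdpair1 _)).
  move=> k copk; apply: holomorph_conj_expg => //.
  by rewrite ox coprime_pexpl.
have lowerQ m : (0 < m)%N -> faithful_qperm_degree rat (Hol C) m ->
    (p ^ n <= m)%N.
  move=> m0 /(qperm_degree_map (ratr : {rmorphism rat -> R[i]})).
  exact: lowerC.
have pn_gt0 : (0 < p ^ n)%N by rewrite expn_gt0 prime_gt0.
have upper : faithful_perm_degree (Hol C) (p ^ n).
  by rewrite -hcard; apply: holomorph_perm_degree.
split; split=> //; try exact: perm_degree_qperm_degree.
by move=> m m0 /(@perm_degree_qperm_degree rat); apply: lowerQ.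
Qed.
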